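(* Let $q\ge p\ge 1$ be integers, let $G_{\mathbb R}=SO_e(2p,2q+1)$, and let $c_3^{p,q}$ be the constant attached (as defined in the context) to the third real form of $\mathcal O^{\mathbb C}$, i.e. to $$h=h_3=(\underbrace{1,\dots,1}_{p-1},0\,|\,2,\underbrace{1,\dots,1}_{p-1},\underbrace{0,\dots,0}_{q-p}).$$ Then $$c_3^{p,q}=0.$$
   Context: Notation: $\mathfrak g=\mathfrak{so}(2p+2q+1,\mathbb C)$ is the complexified Lie algebra of $G_{\mathbb R}$, with Cartan decomposition $\mathfrak g=\mathfrak k\oplus\mathfrak p$, $\mathfrak k\cong\mathfrak{so}(2p)\oplus\mathfrak{so}(2q+1)$, and $\mathfrak h\subset\mathfrak k$ is a compact Cartan subalgebra. $\mathfrak h$ and $\mathfrak h^*$ are identified with $\mathbb C^{p+q}$ with standard coordinates $\varepsilon_1,\dots,\varepsilon_{p+q}$ and standard bilinear form $\langle\ ,\ \rangle$; the bar $|$ in coordinate expressions separates the first $p$ from the last $q$ coordinates. Positive roots: $\Delta^+=\{\varepsilon_i\pm\varepsilon_j\mid i<j\}\cup\{\varepsilon_i\}$ ($1\le i<j\le p+q$). Compact roots: $\pm\varepsilon_i\pm\varepsilon_j$ with $i\neq j$ both $\le p$ or both $>p$, and $\pm\varepsilon_j$ with $j>p$; the remaining roots are noncompact. Set $\Delta_c^+$ = positive compact roots, $\rho_c$ = half their sum, and $$P_K(\lambda)=\prod_{\alpha\in\Delta_c^+}\frac{\langle\lambda,\alpha\rangle}{\langle\rho_c,\alpha\rangle}.$$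 $\mathcal O^{\mathbb C}$ is the complex nilpotent orbit with partition $[3,2^{2p-2},1^{2(q-p+1)}]$; its real forms are nilpotent $K$-orbits in $\mathfrak p$ (where $K$ is the complexification of the maximal compact subgroup), and $h$ is the semisimple element of the $\mathfrak{sl}_2$-triple of the real form. Definition of the constant attached to $h$. Let $\mathfrak l$ be the centralizer of $h$ in $\mathfrak g$, $\Delta(\mathfrak l)=\{\alpha\mid\alpha(h)=0\}$ its roots, $\Delta^+(\mathfrak l)=\Delta(\mathfrak l)\cap\Delta^+$, and $\Delta_n^+(\mathfrak l)$ the set of noncompact roots in $\Delta^+(\mathfrak l)$, with half sum $\rho_n(\mathfrak l)$. $P_{L\cap K}$ is the Weyl dimension polynomial of $\mathfrak l\cap\mathfrak k$, i.e. $P_{L\cap K}(\lambda)=\prod\langle\lambda,\alpha\rangle/\langle\rho_{\mathfrak l\cap\mathfrak k},\alpha\rangle$, the product over compact $\alpha\in\Delta^+(\mathfrak l)$ and $\rho_{\mathfrak l\cap\mathfrak k}$ being half the sum of these roots. Let $\Delta(\mathfrak p_1)$ be the set of noncompact roots $\alpha$ with $\alpha(h)=1$, let $N=\#\{\alpha\in\Delta^+\mid\alpha(h)>0\}$, and for a set $A$ of roots let $\rho(A)$ be half the sum of its elements. The constant $c=c(h)$ is defined by the polynomial identity in $\lambda\in\mathfrak h^*$ $$(-1)^N\sum_{A\subseteq\Delta_n^+(\mathfrak l),\ C\subseteq\Delta(\mathfrak p_1)}(-1)^{\#A+\#C}P_K(\lambda-\rho_n(\mathfrak l)+2\rho(A)-2\rho(C))=c\,P_{L\cap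 K}(\lambda);$$ it is known from earlier work that the left side is a constant multiple of $P_{L\cap K}$. *)

(* Defs.v *)
From mathcomp Require Import all_boot all_order all_algebra.
From mathcomp Require Import finmap reals complex.

Set Implicit Arguments.
Unset Strict Implicit.
Unset Printing Implicit Defensive.

Import Order.TTheory GRing.Theory Num.Theory.
Local Open Scope fset_scope.
Local Open Scope ring_scope.

Section RootData.
Variables (R : realType) (p q : nat).

(* The Cartan subalgebra and its dual are both C^(p+q), as row vectors.
   Coordinates are numbered from 0, so the first block is i < p and the second p <= i. *)
Notation V := 'rV[R[i]]_(p + q).

(* The bilinear (not Hermitian) form; it also evaluates a root alpha at
   h : V, i.e. alpha(h) = form alpha h. *)
Definition form (x y : V) : R[i] := \sum_(k < p + q) x 0 k * y 0 k.

Definition eps (k : 'I_(p + q)) : V := delta_mx 0 k.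

Definition sgeps (s : bool) (k : 'I_(p + q)) : V := (-1) ^+ s *: eps k.

Definition same_block (k l : 'I_(p + q)) : bool := (k < p)%N == (l < p)%N.

Definition roots : {fset V} :=
  [fset sgeps st.1 kl.1 + sgeps st.2 kl.2
     | st : (bool * bool)%type, kl : ('I_(p + q) * 'I_(p + q))%type
     & kl.1 != kl.2]
  `|` [fset sgeps s k | s : bool, k : 'I_(p + q)].

Definition pos_roots : {fset V} :=
  [fset eps kl.1 + sgeps s kl.2
     | s : bool, kl : ('I_(p + q) * 'I_(p + q))%type & (kl.1 < kl.2)%N]
  `|` [fset eps k | k : 'I_(p + q)].

Definition compact_roots : {fset V} :=
  [fset sgeps st.1 kl.1 + sgeps st.2 kl.2
     | st : (bool * bool)%type, kl : ('I_(p + q) * 'I_(p + q))%type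
     & (kl.1 != kl.2) && same_block kl.1 kl.2]
  `|` [fset sgeps s k | s : bool, k : 'I_(p + q) & (p <= k)%N].

Definition noncompact_roots : {fset V} := roots `\` compact_roots.

Definition half_sum (A : {fset V}) : V := 2^-1 *: \sum_(alpha <- A) alpha.

Definition weyl_poly (A : {fset V}) (lambda : V) : R[i] :=
  \prod_(alpha <- A) (form lambda alpha / form (half_sum A) alpha).

Definition P_K : V -> R[i] := weyl_poly (pos_roots `&` compact_roots).

Section Orbit.
Variable h : V.

Definition pos_roots_l : {fset V} :=
  [fset alpha in pos_roots | form alpha h == 0].

Definition P_LK : V -> R[i] := weyl_poly (pos_roots_l `&` compact_roots).

Definition pos_noncompact_l : {fset V} := pos_roots_l `&` noncompact_roots.

Definition roots_p1 : {fset V} :=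
  [fset alpha in noncompact_roots | form alpha h == 1].

Definition num_pos : nat := #|` [fset alpha in pos_roots | 0 < form alpha h]|.

Definition alternating_sum (lambda : V) : R[i] :=
  (-1) ^+ num_pos *
  \sum_(A <- fpowerset pos_noncompact_l) \sum_(C <- fpowerset roots_p1)
    (-1) ^+ (#|` A| + #|` C|) *
    P_K (lambda - half_sum pos_noncompact_l
         + 2 *: half_sum A - 2 *: half_sum C).

(* At most one c satisfies this, since P_LK is not identically zero. *)
Definition is_orbit_constant (c : R[i]) : Prop :=
  forall lambda : V, alternating_sum lambda = c * P_LK lambda.

End Orbit.

(* (1^(p-1), 0 | 2, 1^(p-1), 0^(q-p)), of length p + q when 1 <= p <= q. *)
Definition h3 : V :=
  \row_(k < p + q)
    (nseq p.-1 1 ++ [:: 0; 2] ++ nseq p.-1 1 ++ nseq (q - p) 0)`_k.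

End RootData.

Arguments h3 : clear implicits.

(* Main.v *)
(** Let s negate the p-th coordinate, the last one of the first block. It fixes
    h_3, permutes the positive compact roots and Delta(p_1), and P_K and P_{L\cap K}
    are s-invariant. On Delta_n^+(l) the map -s permutes the roots involving
    the p-th coordinate, and there is an odd number of them: eps_p, and pairs
    eps_p + eps_j, eps_p - eps_j. As the sum over A amounts to applying the product
    over beta in Delta_n^+(l) of the differences T_{-beta/2} - T_{beta/2} of
    translations, the alternating sum is s-odd, whereas c P_{L\cap K} is s-even;
    hence c = 0, since P_{L\cap K} is not identically zero. *)

From mathcomp Require Import all_boot all_order all_algebra.
From mathcomp Require Import finmap reals complex.
From mathcomp Require Import perm ring.
(* Imported last: [all_algebra] also exports a [form]. *)
Require Import Defs.

Set Implicit Arguments.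
Unset Strict Implicit.
Unset Printing Implicit Defensive.

Import Order.TTheory GRing.Theory Num.Theory.
Local Open Scope fset_scope.
Local Open Scope ring_scope.

(** * Reindexing and restricting big operators over finite sets *)

Section InvolutionOnFset.
Variables (T : choiceType) (A : {fset T}) (g : T -> T).
Hypotheses (gA : {in A, forall x, g x \in A}) (gK : {in A, involutive g}).

Lemma big_involution (I : Type) (idx : I) (op : Monoid.com_law idx)
    (F : T -> I) :
  \big[op/idx]_(x <- A) F (g x) = \big[op/idx]_(x <- A) F x.
Proof.
rewrite -(big_map g xpredT F) /=; apply: perm_big; apply: uniq_perm.
- by rewrite map_inj_in_uniq ?fset_uniq // => x y xA yA /(congr1 g); rewrite !gK.
- exact: fset_uniq.
move=> x; apply/mapP/idP => [[y yA ->]|xA]; first exact: gA.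
by exists (g x); rewrite ?gK ?gA.
Qed.

End InvolutionOnFset.

Section BigSubset.
Variables (T : choiceType) (A B : {fset T}).
Hypothesis sAB : A `<=` B.

Lemma big_fsubset (I : Type) (idx : I) (op : Monoid.com_law idx) (F : T -> I) :
  \big[op/idx]_(x <- A) F x =
  \big[op/idx]_(x <- B) (if x \in A then F x else idx).
Proof.
rewrite -big_mkcond -[in RHS]big_filter; apply: perm_big.
apply: uniq_perm; rewrite ?filter_uniq ?fset_uniq // => x.
rewrite mem_filter /=; case xA: (x \in A); last by [].
by rewrite (fsubsetP sAB).
Qed.

End BigSubset.

(** Turns the sign of a subset into a product, so that the signs of two subsets can be compared
    factor by factor. *)
Lemma signr_card (T : choiceType) (K : pzRingType) (A : {fset T}) :
  (-1) ^+ #|` A| = \prod_(x <- A) (-1 : K).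
Proof. by rewrite card_fset_sum1 big_seq_fsetE -prodrXr big_seq_fsetE. Qed.

(** * The bilinear form and the root system of type B *)

Section RootSystem.
Variables (R : realType) (p q : nat).
Local Notation V := 'rV[R[i]]_(p + q).
Local Notation index := 'I_(p + q).
Implicit Types (x y v w : V) (k l : index) (A : {fset V}).

Lemma formE x y : form x y = (x *m y^T) 0 0.
Proof. by rewrite mxE; apply: eq_bigr => k _; rewrite mxE. Qed.

Lemma formC x y : form x y = form y x.
Proof. by apply: eq_bigr => k _; rewrite mulrC. Qed.

Lemma formDl x y v : form (x + y) v = form x v + form y v.
Proof. by rewrite !formE mulmxDl mxE. Qed.

Lemma formNl x y : form (- x) y = - form x y.
Proof. by rewrite !formE mulNmx mxE. Qed.

Lemma formZl a x y : form (a *: x) y = a * form x y.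
Proof. by rewrite !formE -scalemxAl mxE. Qed.

Lemma formBl x y v : form (x - y) v = form x v - form y v.
Proof. by rewrite formDl formNl. Qed.

Lemma form_suml (I : Type) (r : seq I) (F : I -> V) y :
  form (\sum_(i <- r) F i) y = \sum_(i <- r) form (F i) y.
Proof.
elim/big_rec2: _ => [|i u v _ <-]; last by rewrite formDl.
by rewrite formE mul0mx mxE.
Qed.

Lemma form_sgeps s k y : form (sgeps R s k) y = (-1) ^+ s * y 0 k.
Proof.
rewrite /sgeps formZl /form (bigD1 k) //= big1 => [|l lk].
  by rewrite mxE !eqxx mul1r addr0.
by rewrite mxE eqxx (negPf lk) mul0r.
Qed.

Lemma sgepsE s k l : sgeps R s k 0 l = (-1) ^+ s * (l == k)%:R.
Proof. by rewrite !mxE eqxx. Qed.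

Lemma sgepsF k : eps R k = sgeps R false k.
Proof. by rewrite /sgeps scale1r. Qed.

Lemma sgepsN s k : - sgeps R s k = sgeps R (~~ s) k.
Proof. by rewrite /sgeps signrN scaleNr. Qed.

Lemma pos_rootsP v :
  v \in pos_roots R p q <->
  (exists s k l, [/\ (k < l)%N & v = sgeps R false k + sgeps R s l]) \/
  (exists k, v = sgeps R false k).
Proof.
rewrite in_fsetU; split=> [/orP[/imfset2P|/imfsetP]|[[s [k [l [kl ->]]]]|[k ->]]].
- by case=> s _ [[k l] kl ->]; left; exists s, k, l; rewrite -sgepsF.
- by case=> k _ ->; right; exists k; rewrite sgepsF.
- by apply/orP; left; apply/imfset2P; exists s => //; exists (k, l);
    rewrite -?sgepsF.
- by apply/orP; right; apply/imfsetP; exists k => //; rewrite sgepsF.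
Qed.

Lemma rootsP v :
  v \in roots R p q <->
  (exists s t k l, k != l /\ v = sgeps R s k + sgeps R t l) \/
  (exists s k, v = sgeps R s k).
Proof.
rewrite in_fsetU; split=>
  [/orP[/imfset2P|/imfset2P]|[[s [t [k [l [kl ->]]]]]|[s [k ->]]]].
- by case=> -[s t] _ [[k l] kl ->]; left; exists s, t, k, l.
- by case=> s _ [k _ ->]; right; exists s, k.
- by apply/orP; left; apply/imfset2P; exists (s, t) => //; exists (k, l).
- by apply/orP; right; apply/imfset2P; exists s => //; exists k.
Qed.

Lemma compact_rootsP v :
  v \in compact_roots R p q <->
  (exists s t k l, [/\ k != l, same_block k l & v = sgeps R s k + sgeps R t l])
  \/ (exists s k, (p <= k)%N /\ v = sgeps R s k).
Proof.
rewrite in_fsetU; split=> [/orP[/imfset2P|/imfset2P]|].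
- by case=> -[s t] _ [[k l] /[!inE]/= /andP[kl b] ->]; left; exists s, t, k, l.
- by case=> s _ [k pk ->]; right; exists s, k.
case=> [[s [t [k [l [kl b ->]]]]]|[s [k [pk ->]]]].
- apply/orP; left; apply/imfset2P; exists (s, t) => //; exists (k, l) => //.
  by rewrite inE /= kl b.
- by apply/orP; right; apply/imfset2P; exists s => //; exists k.
Qed.

Lemma sub_compact_roots v : v \in compact_roots R p q -> v \in roots R p q.
Proof.
move/compact_rootsP=> [[s [t [k [l [kl _ ->]]]]]|[s [k [_ ->]]]]; apply/rootsP.
  by left; exists s, t, k, l.
by right; exists s, k.
Qed.

Lemma sub_pos_roots v : v \in pos_roots R p q -> v \in roots R p q.
Proof.
move/pos_rootsP=> [[s [k [l [kl ->]]]]|[k ->]]; apply/rootsP.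
  by left; exists false, s, k, l; rewrite neq_ltn kl.
by right; exists false, k.
Qed.

Lemma pos_rootsVN v : v \in roots R p q ->
  (v \in pos_roots R p q) \/ (- v \in pos_roots R p q).
Proof.
have pair s t k l : (k < l)%N ->
  (sgeps R s k + sgeps R t l \in pos_roots R p q) \/
  (- (sgeps R s k + sgeps R t l) \in pos_roots R p q).
  move=> kl; rewrite opprD !sgepsN; case: s; [right|left];
    apply/pos_rootsP; left.
    by exists (~~ t), k, l.
  by exists t, k, l.
case/rootsP=> [[s [t [k [l [kl ->]]]]]|[[] [k ->]]].
- move: kl; rewrite neq_ltn => /orP[|] kl; first exact: pair.
  by rewrite addrC; apply: pair.
- by right; rewrite sgepsN; apply/pos_rootsP; right; exists k.
- by left; apply/pos_rootsP; right; exists k.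
Qed.

(** For bijective [f] this is an element of the Weyl group of type B. Negation, the reflections in
    compact roots and the sign change at one coordinate all have this form, so the stability lemmas
    below serve all three. *)
Definition signed_perm (t : index -> bool) (f : index -> index) v : V :=
  \row_k ((-1) ^+ t k * v 0 (f k)).

Section SignedPerm.
Variables (t : index -> bool) (f : index -> index).
Hypothesis fK : involutive f.

Lemma signed_permD v w :
  signed_perm t f (v + w) = signed_perm t f v + signed_perm t f w.
Proof. by apply/rowP=> k; rewrite !mxE mulrDr. Qed.

Lemma signed_perm_sgeps s k :
  signed_perm t f (sgeps R s k) = sgeps R (t (f k) (+) s) (f k).
Proof.
apply/rowP=> l; rewrite mxE !sgepsE mulrA signr_addb (can2_eq fK fK).
by case: eqP => [->|_]; rewrite ?mulr0.
Qed.

Lemma signed_perm_roots v :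
  v \in roots R p q -> signed_perm t f v \in roots R p q.
Proof.
case/rootsP=> [[s [u [k [l [kl ->]]]]]|[s [k ->]]]; apply/rootsP.
  rewrite signed_permD !signed_perm_sgeps; left; do 4 eexists; split; last by [].
  by rewrite (inj_eq (inv_inj fK)).
by rewrite signed_perm_sgeps; right; do 2 eexists.
Qed.

Hypothesis f_block : forall k, same_block (f k) k.

Lemma signed_perm_compact_roots v :
  v \in compact_roots R p q -> signed_perm t f v \in compact_roots R p q.
Proof.
case/compact_rootsP=> [[s [u [k [l [kl b ->]]]]]|[s [k [pk ->]]]];
  apply/compact_rootsP; rewrite ?signed_permD !signed_perm_sgeps.
  left; do 4 eexists; split; last by [].
  - by rewrite (inj_eq (inv_inj fK)).
  - by move: (f_block k) (f_block l) b => /eqP bk /eqP bl; rewrite /same_block bk bl.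
right; do 2 eexists; split; last by [].
by move/eqP: (f_block k) => b; rewrite leqNgt b -leqNgt.
Qed.

End SignedPerm.

Lemma roots_opp v : v \in roots R p q -> - v \in roots R p q.
Proof.
move/(@signed_perm_roots xpredT id (fun=> erefl)).
suff -> : signed_perm xpredT id v = - v by [].
by apply/rowP=> k; rewrite !mxE mulN1r.
Qed.

Lemma compact_roots_opp v : v \in compact_roots R p q -> - v \in compact_roots R p q.
Proof.
move/(@signed_perm_compact_roots xpredT id (fun=> erefl) (fun=> eqxx _)).
suff -> : signed_perm xpredT id v = - v by [].
by apply/rowP=> k; rewrite !mxE mulN1r.
Qed.

(** * Reflections in compact roots *)

Definition reflection v w : V := w - (2 * form w v / form v v) *: v.

Lemma form_root_root v : v \in roots R p q -> 0 < form v v.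
Proof.
case/rootsP=> [[s [t [k [l [kl ->]]]]]|[s [k ->]]].
  rewrite formDl !form_sgeps !mxE !eqxx (negPf kl) eq_sym (negPf kl).
  by rewrite !mulr0 addr0 add0r !mulr1 -!expr2 !sqrr_sign addr_gt0 ?ltr01.
by rewrite form_sgeps sgepsE eqxx mulr1 -expr2 sqrr_sign ltr01.
Qed.

Lemma form_reflection v w : form v v != 0 ->
  form (reflection v w) v = - form w v.
Proof. by move=> vv; rewrite /reflection formBl formZl; field. Qed.

Lemma reflectionK v : form v v != 0 -> involutive (reflection v).
Proof.
move=> vv w; rewrite {1}/reflection form_reflection // /reflection.
by rewrite mulrN mulNr scaleNr opprK subrK.
Qed.

(** The reflection in a root on coordinates [k] and [l] swaps them, negating both exactly when the
    two signs of the root agree; the reflection in a short root negates one coordinate. Both respect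
    the blocks. *)
Lemma reflection_compact_roots v w :
  v \in compact_roots R p q -> w \in compact_roots R p q ->
  reflection v w \in compact_roots R p q.
Proof.
case/compact_rootsP=> [[s [t [k [l [kl b ->]]]]]|[s [k [pk ->]]]] wc.
  pose f : index -> index := tperm k l.
  have fK : involutive f by exact: tpermK.
  have fb m : same_block (f m) m.
    rewrite /f /same_block; case: tpermP => [->|->|_ _] //.
    by rewrite eq_sym.
  suff -> : reflection (sgeps R s k + sgeps R t l) w =
      signed_perm (fun m => ((m == k) || (m == l)) && ~~ (s (+) t)) f w.
    exact: signed_perm_compact_roots.
  rewrite /reflection [form w _]formC !formDl !form_sgeps.
  have lk : (l == k) = false by rewrite eq_sym; apply: negPf.
  apply/rowP=> m; rewrite !mxE !eqxx lk (negPf kl) /f.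
  case: tpermP => [->|->|/eqP mk /eqP ml].
  - rewrite !eqxx (negPf kl) /=.
    by case: s; case: t; rewrite /= ?expr0 ?expr1; field.
  - rewrite !eqxx lk /=.
    by case: s; case: t; rewrite /= ?expr0 ?expr1; field.
  - by rewrite (negPf mk) (negPf ml) /= !mulr0 !addr0 mulr0 subr0 mul1r.
suff -> : reflection (sgeps R s k) w = signed_perm (fun m => m == k) id w.
  by apply: signed_perm_compact_roots => // m; exact: eqxx.
rewrite /reflection [form w _]formC !form_sgeps.
apply/rowP=> m; rewrite !mxE !eqxx /=; case: eqP => [->|_] /=.
  by by case: s; rewrite ?expr0 ?expr1; field.
by rewrite mulr0n !mulr0 subr0 mul1r.
Qed.

(** The vector $(n, n-1, \dots, 1)$ with $n = p+q$, the half sum of the positive coroots. It serves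
    to decide the sign of a root, and later as a point where [P_LK] does not vanish. *)
Definition staircase : V := \row_k (p + q - k)%:R.

Lemma staircase_gt0 k : 0 < staircase 0 k.
Proof. by rewrite mxE ltr0n subn_gt0. Qed.

Lemma form_pos_staircase v : v \in pos_roots R p q -> 0 < form v staircase.
Proof.
case/pos_rootsP=> [[s [k [l [kl ->]]]]|[k ->]]; last first.
  by rewrite form_sgeps mul1r staircase_gt0.
rewrite formDl !form_sgeps mul1r; case: s; last first.
  by rewrite mul1r addr_gt0 ?staircase_gt0.
by rewrite mulN1r subr_gt0 !mxE ltr_nat ltn_sub2l.
Qed.

Lemma root_real v k : v \in roots R p q -> v 0 k \is Num.real.
Proof.
have sgr s l : sgeps R s l 0 k \is Num.real.
  by rewrite sgepsE realM ?realn // realX // realN real1.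
case/rootsP=> [[s [t [l [m [_ ->]]]]]|[s [l ->]]] //.
by rewrite mxE realD.
Qed.

(** The order on [R[i]] is partial: inferring positivity from the failure of [<= 0] requires a real
    pairing. *)
Lemma form_real v w : v \in roots R p q -> w \in roots R p q ->
  form v w \is Num.real.
Proof.
by move=> vr wr; apply: sum_real => k _; rewrite realM ?root_real.
Qed.

(** * Nonvanishing of the dimension polynomial [P_LK] *)

Section PositiveCompactLevi.
Variable h : V.
Local Notation A := (pos_roots_l h `&` compact_roots R p q).

Lemma mem_pos_compact_l v : (v \in A) =
  [&& v \in pos_roots R p q, form v h == 0 & v \in compact_roots R p q].
Proof. by rewrite !inE /= -andbA. Qed.

(* In the sum of [form w v] over [w] in [A], the roots [w] whose reflection in
   [v] stays in [A] cancel in pairs; the other terms are positive. *)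
Lemma form_half_sum_gt0 v : v \in A -> 0 < form (half_sum A) v.
Proof.
move=> vA; move: (vA); rewrite mem_pos_compact_l => /and3P[vp /eqP vh vc].
have vr := sub_pos_roots vp.
have vv := form_root_root vr; have vv0 := lt0r_neq0 vv.
have vs := form_pos_staircase vp.
pose g w := if reflection v w \in A then reflection v w else w.
have gA : {in A, forall w, g w \in A} by move=> w wA; rewrite /g; case: ifP.
have gK : {in A, involutive g}.
  move=> w wA; rewrite {2}/g; case: ifP => [rA|rA]; rewrite /g.
    by rewrite reflectionK // wA.
  by rewrite rA.
rewrite /half_sum formZl form_suml mulr_gt0 ?invr_gt0 ?ltr0n //.
have := big_involution gA gK +%R (fun w => form w v).
set S := (X in _ = X) => gS.
(* Since [g] permutes [A], this sum is twice [S]. *)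
suff: 0 < \sum_(w <- A) (form (g w) v + form w v).
  by rewrite big_split /= gS -/S -mulr2n pmulrn_lgt0.
(* The reflected root is still compact and in $\Delta(\mathfrak l)$, so it can leave [A] only by
   being negative. If [form w v <= 0], it would be [w] plus a nonnegative multiple of [v], hence
   positive on [staircase]. *)
have fixed w : w \in A -> reflection v w \notin A -> 0 < form w v.
  rewrite !mem_pos_compact_l => /and3P[wp /eqP wh wc].
  have rc : reflection v w \in compact_roots R p q.
    exact: reflection_compact_roots.
  have rh : form (reflection v w) h = 0.
    by rewrite /reflection formBl formZl wh vh mulr0 subr0.
  rewrite rc rh eqxx !andbT => /negP rNp.
  have [//|rp] := pos_rootsVN (sub_compact_roots rc).
  have := form_pos_staircase rp.
  rewrite formNl oppr_gt0 => neg.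
  rewrite real_ltNge ?real0 ?form_real ?(sub_pos_roots wp) //.
  apply: contraTN neg => wv; rewrite /reflection formBl formZl lt_gtF //.
  rewrite subr_gt0 (le_lt_trans _ (form_pos_staircase wp)) //.
  by rewrite mulr_le0_ge0 ?(ltW vs) // pmulr_lle0 ?invr_gt0 // pmulr_rle0.
have term_ge0 w : w \in A -> 0 <= form (g w) v + form w v.
  move=> wA; rewrite /g; case: ifPn => rA.
    by rewrite form_reflection // addNr.
  by rewrite addr_ge0 ?ltW ?fixed.
(* Strictness comes from the term at [v]: its reflection [- v] is outside [A], so [g] fixes [v]. *)
rewrite (bigD1_seq v) ?fset_uniq //= ltr_wpDr //.
  by rewrite big_seq_cond sumr_ge0 // => w /andP[/term_ge0].
have vN : reflection v v \notin A.
  rewrite mem_pos_compact_l; apply/negP => /and3P[/form_pos_staircase + _ _].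
  by rewrite /reflection mulfK // formBl formZl subr_gt0 lt_gtF // ltr_pMl ?ltr1n.
by rewrite /g (negPf vN) addr_gt0.
Qed.

(** The denominators matter too: as the inverse of 0 is 0, a vanishing one would kill the product.
    They are positive by [form_half_sum_gt0], the numerators by [form_pos_staircase]. *)
Lemma P_LK_staircase_neq0 : P_LK h staircase != 0.
Proof.
rewrite prodf_seq_neq0; apply/allP=> v vA /=.
have vp : v \in pos_roots R p q by move: vA; rewrite mem_pos_compact_l => /andP[].
rewrite mulf_neq0 ?invr_eq0 //; last exact: lt0r_neq0 (form_half_sum_gt0 vA).
by rewrite formC; apply: lt0r_neq0 (form_pos_staircase vp).
Qed.

End PositiveCompactLevi.

(** * The sign change at the pivot, the last coordinate of the first block *)

Section Pivot.
Variable k0 : index.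
Hypothesis k0p : k0.+1 = p.

Local Notation flip := (signed_perm (fun k : index => k == k0) id).

Let k0_lt : (k0 < p)%N := eq_leq k0p.

Lemma flipK : involutive flip.
Proof. by move=> v; apply/rowP=> k; rewrite !mxE mulrA -expr2 sqrr_sign mul1r. Qed.

Lemma flipD v w : flip (v + w) = flip v + flip w.
Proof. exact: signed_permD. Qed.

Lemma flipZ a v : flip (a *: v) = a *: flip v.
Proof. by apply/rowP=> k; rewrite !mxE mulrCA. Qed.

Lemma flipN v : flip (- v) = - flip v.
Proof. by rewrite -scaleN1r flipZ scaleN1r. Qed.

Lemma flip_sum (I : Type) (r : seq I) (F : I -> V) :
  flip (\sum_(i <- r) F i) = \sum_(i <- r) flip (F i).
Proof.
elim/big_rec2: _ => [|i u v _ <-]; last exact: flipD.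
by rewrite -(scale0r 0) flipZ !scale0r.
Qed.

Lemma form_flip v w : form (flip v) w = form v (flip w).
Proof. by apply: eq_bigr => k _; rewrite !mxE mulrA [_ * v 0 k]mulrC. Qed.

Lemma flip_pivot v : flip v 0 k0 = - v 0 k0.
Proof. by rewrite mxE eqxx mulN1r. Qed.

Lemma flip_id v : v 0 k0 = 0 -> flip v = v.
Proof.
move=> v0; apply/rowP=> k; rewrite mxE /=.
by case: eqP => [->|_]; rewrite ?v0 ?mulr0 ?mul1r.
Qed.

Lemma flip_sgeps s k : flip (sgeps R s k) = sgeps R ((k == k0) (+) s) k.
Proof. exact: signed_perm_sgeps. Qed.

Lemma flip_compact_roots v :
  v \in compact_roots R p q -> flip v \in compact_roots R p q.
Proof. by apply: signed_perm_compact_roots => // k; exact: eqxx. Qed.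

Lemma noncompact_rootsP v : reflect
  (v \in roots R p q /\ v \notin compact_roots R p q)
  (v \in noncompact_roots R p q).
Proof. by rewrite in_fsetD andbC; exact: andP. Qed.

Lemma flip_noncompact_roots v :
  v \in noncompact_roots R p q -> flip v \in noncompact_roots R p q.
Proof.
move=> /noncompact_rootsP[vr vc]; apply/noncompact_rootsP; split.
  exact: signed_perm_roots.
by apply: contra vc => /flip_compact_roots; rewrite flipK.
Qed.

Lemma noncompact_roots_opp v :
  v \in noncompact_roots R p q -> - v \in noncompact_roots R p q.
Proof.
move=> /noncompact_rootsP[vr vc]; apply/noncompact_rootsP; split.
  exact: roots_opp.
by apply: contra vc => /compact_roots_opp; rewrite opprK.
Qed.

(** Short compact roots live in the second block and compact pairs stay inside one block. This is
    the test that shows roots at the pivot to be noncompact. *)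
Lemma compact_root_support v k :
  v \in compact_roots R p q -> (k < p)%N -> v 0 k != 0 ->
  exists l, [/\ l != k, (l < p)%N & v 0 l != 0].
Proof.
have witness s t a b : a != b -> same_block a b -> (k < p)%N -> k = a ->
    exists l, [/\ l != k, (l < p)%N & (sgeps R s a + sgeps R t b) 0 l != 0].
  move=> ab /eqP same kp ka; subst a; exists b.
  split; rewrite -?same //; first by rewrite eq_sym.
  by rewrite mxE !sgepsE eqxx [b == k]eq_sym (negPf ab) mulr0 add0r mulr1 signr_eq0.
case/compact_rootsP=> [[s [t [a [b [ab same ->]]]]]|[s [a [pa ->]]]] kp.
  rewrite mxE !sgepsE; case: (k =P a) => [ka _|_]; first exact: witness ka.
  case: (k =P b) => [kb _|_]; last by rewrite !mulr0 addr0 eqxx.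
  by rewrite addrC; apply: witness kb; rewrite 1?eq_sym // /same_block eq_sym.
rewrite sgepsE; case: (k =P a) => [ka|_]; last by rewrite mulr0 eqxx.
by move: kp; rewrite ka ltnNge pa.
Qed.

(** As the pivot ends the first block, the first two shapes are noncompact and the third is
    compact. *)
Lemma pos_root_pivotP v : v \in pos_roots R p q -> v 0 k0 != 0 ->
  [\/ v = sgeps R false k0,
      exists s l, (k0 < l)%N /\ v = sgeps R false k0 + sgeps R s l
    | exists s k, (k < k0)%N /\ v = sgeps R false k + sgeps R s k0].
Proof.
case/pos_rootsP=> [[s [k [l [kl ->]]]]|[k ->]]; last first.
  by rewrite sgepsE; case: (k0 =P k) => [->|_]; [constructor | rewrite mulr0 eqxx].
rewrite mxE !sgepsE; case: (k0 =P k) kl => [<-|_] kl.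
  by move=> _; constructor 2; exists s, l.
case: (k0 =P l) kl => [<-|_] kl; last by rewrite !mulr0 addr0 eqxx.
by move=> _; constructor 3; exists s, k.
Qed.

Lemma pivot_noncompact : sgeps R false k0 \in noncompact_roots R p q.
Proof.
apply/noncompact_rootsP; split; first by apply/rootsP; right; do 2 eexists.
apply/negP => /compact_root_support /(_ k0_lt)[|l [lk _]].
- by rewrite sgepsE eqxx mulr1 signr_eq0.
by rewrite sgepsE (negPf lk) mulr0 eqxx.
Qed.

Lemma pivot_pair_noncompact s l : (k0 < l)%N ->
  sgeps R false k0 + sgeps R s l \notin compact_roots R p q.
Proof.
move=> kl; apply/negP => /compact_root_support /(_ k0_lt)[|m [mk mp]].
- rewrite mxE !sgepsE eqxx mul1r.
  case: (k0 =P l) kl => [<-|_ _]; first by rewrite ltnn.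
  by rewrite mulr0 addr0 oner_eq0.
rewrite mxE !sgepsE (negPf mk) mulr0 add0r; case: (m =P l) => [ml|_].
  by move: mp kl; rewrite ml k0p ltnNge => /negP.
by rewrite mulr0 eqxx.
Qed.

(** In a compact positive root the pivot can only be the second index, whose sign is free. *)
Lemma flip_pos_compact v : v \in pos_roots R p q ->
  v \in compact_roots R p q -> flip v \in pos_roots R p q.
Proof.
move=> vp vc; have [v0|/(pos_root_pivotP vp)] := eqVneq (v 0 k0) 0.
  by rewrite flip_id.
case=> [ve|[s [l [kl ve]]]|[s [k [kl ->]]]].
- by case/noncompact_rootsP: pivot_noncompact; rewrite -ve vc.
- by case/negP: (pivot_pair_noncompact s kl); rewrite -ve.
rewrite flipD !flip_sgeps eqxx -val_eqE (ltn_eqF kl) /=.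
by apply/pos_rootsP; left; exists (~~ s), k, k0.
Qed.

(** Here the pivot is the leading index: [flip] makes its coefficient negative and the opposite
    restores it. *)
Lemma opp_flip_pos_noncompact v : v \in pos_roots R p q ->
  v \in noncompact_roots R p q -> v 0 k0 != 0 -> - flip v \in pos_roots R p q.
Proof.
move=> vp /noncompact_rootsP[_ /negP vc] /(pos_root_pivotP vp).
case=> [->|[s [l [kl ->]]]|[s [k [kl ve]]]].
- by rewrite flip_sgeps eqxx sgepsN; apply/pos_rootsP; right; exists k0.
- rewrite flipD !flip_sgeps opprD !sgepsN eqxx -val_eqE (gtn_eqF kl) /=.
  by apply/pos_rootsP; left; exists (~~ s), k0, l.
case: vc; rewrite ve; apply/compact_rootsP; left; exists false, s, k, k0.
by rewrite /same_block neq_ltn kl k0_lt (ltn_trans kl).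
Qed.

(** [flip] is self-adjoint and permutes [A], hence fixes its half sum; reindexing the product does
    the rest. *)
Lemma weyl_poly_flip A v : {in A, forall w, flip w \in A} ->
  weyl_poly A (flip v) = weyl_poly A v.
Proof.
move=> fA; have fK : {in A, involutive flip} by move=> w _; exact: flipK.
have frho : flip (half_sum A) = half_sum A.
  by rewrite /half_sum flipZ flip_sum (big_involution fA fK +%R id).
rewrite /weyl_poly -[RHS](big_involution fA fK).
by apply: eq_bigr => w _; rewrite form_flip -(form_flip (half_sum A)) frho.
Qed.

Lemma P_K_flip v : P_K (flip v) = P_K v.
Proof.
apply: weyl_poly_flip => w /fsetIP[wp wc].
by rewrite in_fsetI flip_pos_compact ?flip_compact_roots.
Qed.

(** * Oddness of the alternating sum when [h] vanishes at the pivot *)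

Section LeviFlip.
Variable h : V.
Hypothesis h0 : h 0 k0 = 0.

Lemma form_flip_h v : form (flip v) h = form v h.
Proof. by rewrite form_flip (flip_id h0). Qed.

Lemma P_LK_flip v : P_LK h (flip v) = P_LK h v.
Proof.
apply: weyl_poly_flip => w; rewrite !mem_pos_compact_l form_flip_h.
by case/and3P=> wp -> wc; rewrite flip_pos_compact ?flip_compact_roots.
Qed.

Local Notation B := (pos_noncompact_l h).
Local Notation G := (roots_p1 h).

Lemma mem_pos_noncompact_l v : (v \in B) =
  [&& v \in pos_roots R p q, form v h == 0 & v \in noncompact_roots R p q].
Proof. by rewrite in_fsetI !inE /= -andbA. Qed.

(** The case split keeps roots positive: away from the pivot [- flip] is plain negation. *)
Definition pivot_opp v : V := if v 0 k0 == 0 then v else - flip v.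

Lemma pivot_opp_pivot v : pivot_opp v 0 k0 = v 0 k0.
Proof. by rewrite /pivot_opp; case: ifP => // _; rewrite mxE flip_pivot opprK. Qed.

Lemma pivot_oppK : involutive pivot_opp.
Proof.
move=> v; rewrite {1}/pivot_opp pivot_opp_pivot.
case: ifP => v0; rewrite /pivot_opp v0 //.
by rewrite flipN flipK opprK.
Qed.

Lemma pivot_opp_mem : {in B, forall v, pivot_opp v \in B}.
Proof.
move=> v vB; rewrite /pivot_opp; case: ifPn => // v0.
move: vB; rewrite !mem_pos_noncompact_l formNl form_flip_h oppr_eq0.
case/and3P=> vp -> vn; rewrite opp_flip_pos_noncompact //.
exact: noncompact_roots_opp (flip_noncompact_roots vn).
Qed.

(* [pivot_opp] pairs off the roots of [B] involving the pivot coordinate, except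
   for the short root at the pivot; it negates their pairing with [w]. *)
Lemma odd_pivot_roots :
  \prod_(v <- B) (if v 0 k0 == 0 then 1 else -1) = -1 :> R[i].
Proof.
set e := sgeps R false k0.
have e0 : e 0 k0 != 0 by rewrite sgepsE eqxx mulr1 oner_eq0.
have eB : e \in B.
  rewrite mem_pos_noncompact_l pivot_noncompact form_sgeps h0 mulr0 eqxx !andbT.
  by apply/pos_rootsP; right; exists k0.
have ge : pivot_opp e = e.
  by rewrite /pivot_opp (negPf e0) flip_sgeps eqxx sgepsN.
have gB : {in B `\ e, forall v, pivot_opp v \in B `\ e}.
  move=> v /fsetD1P[ve vB]; rewrite in_fsetD1 pivot_opp_mem // andbT.
  by apply: contra_neq ve => /(congr1 pivot_opp); rewrite pivot_oppK ge.
rewrite (big_fsetD1 e) //= (negPf e0).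
suff -> : \prod_(v <- B `\ e) (if v 0 k0 == 0 then 1 else -1) = 1 :> R[i].
  by rewrite mulr1.
(* [w] is fixed by [flip] and takes the value 1 or -1 on each remaining root at the pivot, so the
   product of [F] is nonzero. Reindexing it by [pivot_opp] multiplies it by the product of signs,
   which is therefore 1. *)
pose w : V := \row_k (k != k0)%:R.
have fw : flip w = w by apply: flip_id; rewrite mxE eqxx.
pose F v : R[i] := if v 0 k0 == 0 then 1 else form v w.
have /mulIf inj : \prod_(v <- B `\ e) F v != 0.
  rewrite prodf_seq_neq0; apply/allP=> v /fsetD1P[ve]; rewrite /F /=.
  rewrite mem_pos_noncompact_l => /and3P[vp _ /noncompact_rootsP[_ vc]].
  case: ifPn => [_|v0]; first exact: oner_neq0.
  case: (pos_root_pivotP vp v0) => [/eqP|[s [l [kl ->]]]|[s [k [kl vE]]]].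
  - by rewrite (negPf ve).
  - rewrite formDl !form_sgeps !mxE eqxx mulr0 add0r -val_eqE (gtn_eqF kl) mulr1.
    by rewrite signr_eq0.
  case/negP: vc; rewrite vE; apply/compact_rootsP; left; exists false, s, k, k0.
  by rewrite /same_block neq_ltn kl k0_lt (ltn_trans kl).
apply: inj; rewrite mul1r -big_split /=.
rewrite -[RHS](big_involution gB (fun v _ => pivot_oppK v)).
apply: eq_bigr => v _; rewrite /F pivot_opp_pivot /pivot_opp.
by case: ifP => _; rewrite ?mul1r // formNl form_flip fw mulN1r.
Qed.

(* Complements [A] among the roots involving the pivot, after [pivot_opp]. *)
Definition twist A : {fset V} :=
  [fset v in B | (pivot_opp v \in A) (+) (v 0 k0 != 0)].

Lemma twist_sub A : twist A `<=` B.
Proof. by apply/fsubsetP=> v; rewrite !inE /= => /andP[]. Qed.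

Lemma mem_twist A v : v \in B ->
  (v \in twist A) = (pivot_opp v \in A) (+) (v 0 k0 != 0).
Proof. by move=> vB; rewrite in_fset inE /= vB. Qed.

Lemma twistK A : A `<=` B -> twist (twist A) = A.
Proof.
move=> /fsubsetP AB; apply/fsetP=> v; case vB: (v \in B); last first.
  apply/idP/idP => [/(fsubsetP (twist_sub _))|/AB]; by rewrite vB.
by rewrite !mem_twist ?pivot_opp_mem // pivot_opp_pivot pivot_oppK addbK.
Qed.

(** Moves the dependence on [A] into a condition over the fixed index set [B], so that [A] and
    [twist A] can be compared termwise. *)
Lemma big_twist (I : Type) (idx : I) (op : Monoid.com_law idx) (F : V -> I) A :
  \big[op/idx]_(v <- twist A) F v =
  \big[op/idx]_(v <- B)
    (if (v \in A) (+) (v 0 k0 != 0) then F (pivot_opp v) else idx).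
Proof.
rewrite (big_fsubset (twist_sub A)).
rewrite -(big_involution pivot_opp_mem (fun v _ => pivot_oppK v)).
apply: eq_big_seq => v vB.
by rewrite mem_twist ?pivot_opp_mem // pivot_opp_pivot pivot_oppK.
Qed.

(** Complementing inside an odd set of roots changes the parity of the cardinality;
    [odd_pivot_roots] supplies the sign. *)
Lemma sign_twist A : A `<=` B ->
  (-1) ^+ #|` twist A| = - (-1) ^+ #|` A| :> R[i].
Proof.
move=> AB; rewrite !signr_card big_twist (big_fsubset AB) /=.
rewrite -[RHS]mulN1r -[X in _ = X * _]odd_pivot_roots -big_split.
apply: eq_bigr => v _ /=.
by case: (v \in A); case: (v 0 k0 == 0); rewrite /= ?mulr1 ?mul1r ?mulrNN ?mulr1.
Qed.

Lemma scale_half_sum A : 2 *: half_sum A = \sum_(v <- A) v.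
Proof. by rewrite /half_sum scalerA mulfV ?scale1r // pnatr_eq0. Qed.

(** The shift is the sum over [B] of $\pm v/2$, with the plus sign on [A]. At the pivot, the sign in
    [- flip v] cancels the one from complementing. *)
Lemma shift_twist A : A `<=` B ->
  - half_sum B + 2 *: half_sum (twist A) = flip (- half_sum B + 2 *: half_sum A).
Proof.
move=> AB; rewrite !scale_half_sum flipD flipN flip_sum big_twist.
rewrite (big_fsubset AB) /=.
rewrite /half_sum flipZ flip_sum -!scaleNr.
(* Reindexing the sum behind [half_sum B] by [pivot_opp] aligns it with [big_twist], so both sides
   agree root by root. *)
rewrite -(big_involution pivot_opp_mem (fun v _ => pivot_oppK v) +%R id) /=.
rewrite !scaler_sumr -!big_split; apply: eq_bigr => v _ /=.
have [v0|v0] := eqVneq (v 0 k0) 0.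
  rewrite /pivot_opp v0 eqxx addbF.
  by case: ifP => _; rewrite (flip_id v0) // flip_id // mxE.
rewrite /pivot_opp (negPf v0) addbT.
by case: (v \in A); apply/rowP=> k; rewrite /= !mxE; field.
Qed.

Definition flip_set A : {fset V} := [fset flip v | v in A].

Lemma flip_setK : involutive flip_set.
Proof.
move=> A; apply/fsetP=> v; apply/imfsetP/idP => [[_ /imfsetP[w wA ->] ->]|vA].
  by rewrite flipK.
by exists (flip v); [apply/imfsetP; exists v | rewrite flipK].
Qed.

Lemma card_flip_set A : #|` flip_set A| = #|` A|.
Proof. exact: card_imfset (inv_inj flipK). Qed.

Lemma shift_flip_set A : 2 *: half_sum (flip_set A) = flip (2 *: half_sum A).
Proof.
rewrite !scale_half_sum flip_sum big_imfset //= => v w _ _.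
exact: (inv_inj flipK).
Qed.

Lemma mem_roots_p1 v :
  (v \in G) = (v \in noncompact_roots R p q) && (form v h == 1).
Proof. by rewrite in_fset inE. Qed.

Lemma flip_set_roots_p1 A : A `<=` G -> flip_set A `<=` G.
Proof.
move=> /fsubsetP AG; apply/fsubsetP=> _ /imfsetP[v /AG vG ->]; move: vG.
rewrite !mem_roots_p1 form_flip_h => /andP[vn ->].
by rewrite flip_noncompact_roots.
Qed.

(** Reindex [A] by [twist] and [C] by [flip_set]: the whole argument of [P_K] gets flipped, which
    [P_K_flip] absorbs, and only the sign of [A] changes. *)
Lemma alternating_sum_flip v :
  alternating_sum h (flip v) = - alternating_sum h v.
Proof.
rewrite /alternating_sum -mulrN; congr (_ * _).
have twB : {in fpowerset B, forall A, twist A \in fpowerset B}.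
  by move=> A _; rewrite fpowersetE twist_sub.
have twK : {in fpowerset B, involutive twist}.
  by move=> A; rewrite fpowersetE; exact: twistK.
have flG : {in fpowerset G, forall A, flip_set A \in fpowerset G}.
  by move=> A; rewrite !fpowersetE; exact: flip_set_roots_p1.
rewrite -(big_involution twB twK) -sumrN; apply: eq_big_seq => A.
rewrite fpowersetE => AB.
have flK : {in fpowerset G, involutive flip_set} by move=> C _; exact: flip_setK.
rewrite -[LHS](big_involution flG flK).
rewrite -[RHS]sumrN.
apply: eq_bigr => C _; rewrite card_flip_set !exprD sign_twist // !mulNr.
rewrite shift_flip_set -addrA -addrA [- _ + (_ - _)]addrA shift_twist //.
by rewrite -flipN -!flipD P_K_flip !addrA.
Qed.

Lemma orbit_constant_eq0 c : is_orbit_constant h c -> c = 0.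
Proof.
move=> hc; apply/eqP.
(* Comparing the values at [staircase] and its flip gives $-cP = cP$ with $P \neq 0$. *)
have := hc (flip staircase).
rewrite alternating_sum_flip hc P_LK_flip => /eqP.
rewrite eq_sym -addr_eq0 -mulr2n mulrn_eq0 /= mulf_eq0.
by rewrite (negPf (P_LK_staircase_neq0 h)) orbF.
Qed.

End LeviFlip.
End Pivot.
End RootSystem.

Theorem theorem5p28 (R : realType) (p q : nat) (hp : (1 <= p)%N)
    (hpq : (p <= q)%N) (c : R[i]) :
  is_orbit_constant (h3 R p q) c -> c = 0.
Proof.
have k0_lt : (p.-1 < p + q)%N by rewrite prednK // leq_addr.
(* Coordinates count from 0, so the pivot is [p.-1]; after [p.-1] ones, the entry of [h3] there is
   the 0 preceding the 2. *)
apply: (@orbit_constant_eq0 _ _ _ (Ordinal k0_lt)); first exact: prednK.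
by rewrite mxE nth_cat size_nseq ltnn subnn.
Qed.
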